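(* Let $\lambda\in[0,1]$ and let $W_{\alpha}$ be a bilateral weighted shift such that $P_{\lambda}(W_{\alpha})$ is non-invertible. Then $$4\lambda(1-\lambda)\sigma(W_{\alpha})\equiv\{4\lambda(1-\lambda)\gamma:\gamma\in\sigma(W_{\alpha})\}\subseteq\sigma(P_{\lambda}(W_{\alpha})).$$
   Context: For a bounded sequence $\alpha=\{\alpha_n\}_{n\in\mathbb{Z}}$ of positive numbers, the bilateral weighted shift $W_\alpha$ on $l^2(\mathbb{Z})$ (complex scalars) is defined by $W_\alpha e_n=\alpha_n e_{n+1}$, where $\{e_n\}_{n\in\mathbb{Z}}$ is the standard orthonormal basis. $\sigma(\cdot)$ is the spectrum. A bounded operator $T$ has a unique polar decomposition $T=U|T|$, where $|T|=(T^{*}T)^{1/2}$ and $U$ is a partial isometry with $\mathcal{N}(U)=\mathcal{N}(T)$. The Duggal transform is $T^{D}=|T|U$, the Aluthge transform is $\Delta(T)=|T|^{1/2}U|T|^{1/2}$, and for $\lambda\in[0,1]$ the power mean transform is $P_{\lambda}(T)=(1-\lambda)^2T+\lambda^2T^{D}+2\lambda(1-\lambda)\Delta(T)$. *)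

(* Defs.v *)
From HB Require Import structures.
From mathcomp Require Import all_boot all_order all_algebra.
From mathcomp Require Import complex.
From mathcomp Require Import all_classical all_reals all_analysis.
From mathcomp Require Import ring.

Set Implicit Arguments.
Unset Strict Implicit.
Unset Printing Implicit Defensive.

Import Order.TTheory GRing.Theory Num.Theory.
Import ComplexField.Normc.
Import numFieldNormedType.Exports.

Local Open Scope classical_set_scope.
Local Open Scope complex_scope.
Local Open Scope ring_scope.

(* Sums over Z: the N-th partial sum ranges over -N <= n < N, since Posz k is
   k and Negz k is -(k+1).  These are used only for absolutely convergent
   families, for which the order of summation is irrelevant. *)
Definition psumZ (R : realType) (f : int -> R) (N : nat) : R :=
  \sum_(k < N) (f (Posz k) + f (Negz k)).

Definition sumZ (R : realType) (f : int -> R) : R := limn (psumZ f).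

Definition sumZC (R : realType) (f : int -> R[i]) : R[i] :=
  sumZ (fun n => complex.Re (f n)) +i* sumZ (fun n => complex.Im (f n)).

Definition square_summable (R : realType) : pred (int -> R[i]) :=
  fun x => `[< cvgn (psumZ (fun n => normc (x n) ^+ 2)) >].

Lemma square_summableP (R : realType) (x : int -> R[i]) :
  reflect (exists M : R, forall N, psumZ (fun n => normc (x n) ^+ 2) N <= M)
          (x \in @square_summable R).
Proof.
have nd : {homo psumZ (fun n => normc (x n) ^+ 2) : m n / (m <= n)%N >-> m <= n}.
  apply/nondecreasing_seqP => n.
  by rewrite /psumZ big_ord_recr /= lerDl addr_ge0 ?sqr_ge0.
apply: (iffP (asboolP _)) => [cx|[M xM]].
  by exists (sumZ (fun n => normc (x n) ^+ 2)) => N; exact: nondecreasing_cvgn_le.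
by apply: nondecreasing_is_cvgn => //; exists M => _ [N _ <-].
Qed.

Lemma normc_sqrD (R : realType) (a b : R[i]) :
  normc (a + b) ^+ 2 <= 2 * normc a ^+ 2 + 2 * normc b ^+ 2.
Proof.
case: a b => [a1 a2] [b1 b2] /=.
rewrite !sqr_sqrtr ?addr_ge0 ?sqr_ge0 // -subr_ge0.
have -> : 2 * (a1 ^+ 2 + a2 ^+ 2) + 2 * (b1 ^+ 2 + b2 ^+ 2) -
    ((a1 + b1) ^+ 2 + (a2 + b2) ^+ 2) = (a1 - b1) ^+ 2 + (a2 - b2) ^+ 2.
  by ring.
by rewrite addr_ge0 ?sqr_ge0.
Qed.

Lemma square_summable_submod (R : realType) :
  submod_closed (@square_summable R).
Proof.
split=> [|c x y /square_summableP[M xM] /square_summableP[M' yM']].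
  apply/square_summableP; exists 0 => N.
  by rewrite /psumZ big1 // => k _; rewrite !normc0 expr0n addr0.
apply/square_summableP; exists (2 * normc c ^+ 2 * M + 2 * M') => N.
apply: (@le_trans _ _ (2 * normc c ^+ 2 * psumZ (fun n => normc (x n) ^+ 2) N +
    2 * psumZ (fun n => normc (y n) ^+ 2) N)); last first.
  by apply: lerD; apply: ler_wpM2l => //; rewrite mulr_ge0 ?sqr_ge0.
rewrite /psumZ !mulr_sumr -big_split /=; apply: ler_sum => k _.
rewrite !mulrDr addrACA; apply: lerD.
  by rewrite -mulrA -exprMn -normcM; exact: (normc_sqrD (c * x _) (y _)).
by rewrite -mulrA -exprMn -normcM; exact: (normc_sqrD (c * x _) (y _)).
Qed.

HB.instance Definition _ (R : realType) :=
  GRing.isSubmodClosed.Build R[i] (int -> R[i]) (@square_summable R)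
    (@square_summable_submod R).

Record l2Z (R : realType) : Type := L2Z {
  l2Z_fun :> int -> R[i];
  l2ZP : square_summable l2Z_fun }.

HB.instance Definition _ (R : realType) := [isSub for @l2Z_fun R].
HB.instance Definition _ (R : realType) := [Choice of l2Z R by <:].
HB.instance Definition _ (R : realType) :=
  [SubChoice_isSubLmodule of l2Z R by <:].

Lemma delta_square_summable (R : realType) (n : int) :
  square_summable (fun m : int => ((m == n)%:R : R[i])).
Proof.
apply/(square_summableP (fun m : int => ((m == n)%:R : R[i]))).
pose d (z : int) : nat := if z is Negz k then k else `|z|%N.
exists 2 => N.
have normcb (b : bool) : normc (b%:R : R[i]) ^+ 2 = b%:R.
  by case: b; rewrite ?normc1 ?normc0 ?expr1n ?expr0n.
apply: (@le_trans _ _ (\sum_(k < N) (k == d n :> nat)%:R *+ 2)).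
  apply: ler_sum => k _; rewrite !normcb mulr2n; apply: lerD; rewrite ler_nat.
    by case: (Posz k =P n) => // <-; rewrite eqxx.
  by case: (Negz k =P n) => // <-; rewrite eqxx.
rewrite sumrMnl lerMn2r /= -natr_sum (_ : 1 = 1%:R) // ler_nat.
have [dN|Nd] := ltnP (d n) N.
  rewrite (bigD1 (Ordinal dN)) //= eqxx big1 // => k.
  by rewrite -val_eqE /= => /negbTE ->.
rewrite big1 // => k _; case: eqP => // kd.
by move: (ltn_ord k); rewrite kd ltnNge Nd.
Qed.

Definition l2Z_basis (R : realType) (n : int) : l2Z R :=
  L2Z (@delta_square_summable R n).

Definition inner (R : realType) (x y : l2Z R) : R[i] :=
  sumZC (fun n => x n * (y n)^*).

Definition l2norm (R : realType) (x : l2Z R) : R :=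
  Num.sqrt (complex.Re (inner x x)).

Definition bounded_operator (R : realType) (T : l2Z R -> l2Z R) : Prop :=
  linear T /\ exists M : R, forall x, l2norm (T x) <= M * l2norm x.

Definition invertible (R : realType) (T : l2Z R -> l2Z R) : Prop :=
  exists S : l2Z R -> l2Z R,
    [/\ bounded_operator S, cancel T S & cancel S T].

Definition spectrum (R : realType) (T : l2Z R -> l2Z R) : set R[i] :=
  [set z | ~ invertible (fun x => T x - z *: x)].

(* In [adjoint], [sqrt_operator] and [polar_isometry], the set given to [xget]
   is a singleton for the operators of interest (bounded, resp. positive,
   resp. bounded), so the default value 0 plays no role. *)
Definition adjoint (R : realType) (T : l2Z R -> l2Z R) : l2Z R -> l2Z R :=
  xget 0 [set S | bounded_operator S /\
                  forall x y, inner (T x) y = inner x (S y)].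

(* The order of R[i] makes [0 <= z] say that z is real and nonnegative. *)
Definition positive_operator (R : realType) (T : l2Z R -> l2Z R) : Prop :=
  bounded_operator T /\ forall x, 0 <= inner (T x) x.

Definition sqrt_operator (R : realType) (T : l2Z R -> l2Z R) :
    l2Z R -> l2Z R :=
  xget 0 [set S | positive_operator S /\ S \o S = T].

Definition abs_operator (R : realType) (T : l2Z R -> l2Z R) : l2Z R -> l2Z R :=
  sqrt_operator (adjoint T \o T).

Definition kernel_operator (R : realType) (T : l2Z R -> l2Z R) : set (l2Z R) :=
  [set x | T x = 0].

Definition partial_isometry (R : realType) (U : l2Z R -> l2Z R) : Prop :=
  bounded_operator U /\
  forall x, (forall y, kernel_operator U y -> inner x y = 0) ->
    l2norm (U x) = l2norm x.

Definition polar_isometry (R : realType) (T : l2Z R -> l2Z R) :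
    l2Z R -> l2Z R :=
  xget 0 [set U | [/\ partial_isometry U,
                      kernel_operator U = kernel_operator T &
                      T = U \o abs_operator T]].

Definition duggal (R : realType) (T : l2Z R -> l2Z R) : l2Z R -> l2Z R :=
  abs_operator T \o polar_isometry T.

Definition aluthge (R : realType) (T : l2Z R -> l2Z R) : l2Z R -> l2Z R :=
  sqrt_operator (abs_operator T) \o polar_isometry T \o
  sqrt_operator (abs_operator T).

Definition power_mean (R : realType) (lambda : R) (T : l2Z R -> l2Z R) :
    l2Z R -> l2Z R :=
  fun x => ((1 - lambda) ^+ 2)%:C *: T x + (lambda ^+ 2)%:C *: duggal T x
           + (2 * lambda * (1 - lambda))%:C *: aluthge T x.

Definition bilateral_weighted_shift (R : realType) (alpha : int -> R)
    (W : l2Z R -> l2Z R) : Prop :=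
  [/\ forall n, 0 < alpha n,
      exists M : R, forall n, alpha n <= M,
      bounded_operator W &
      forall n, W (l2Z_basis R n) = (alpha n)%:C *: l2Z_basis R (n + 1)].

(* Main.v *)
(** Write W = V |W| with V the unweighted shift.  Then P_lambda(W) is again a
    weighted shift, with weights
    b_n = ((1 - lambda) sqrt a_n + lambda sqrt a_(n+1))^2, and AM-GM gives
    b_n >= c sqrt (a_n a_(n+1)), where c = 4 lambda (1 - lambda).

    Suppose z = c gamma is not in the spectrum of the non-invertible operator
    P_lambda(W).  The matrix of (P_lambda(W) - z)^-1 satisfies two-term
    recurrences along its diagonals; as the b_n have no positive lower bound
    it must be lower triangular, with entries
    - b_k ... b_(k+n-1) / z^(n+1).  Its boundedness makes
    b_k ... b_(k+n-1) / |z|^n tend to 0 uniformly in k, so by AM-GM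
    a_k ... a_(k+n-1) / |gamma|^n tends to 0 uniformly too.  Hence some power
    of W / gamma is a contraction, and W - gamma is invertible. *)
Require Import Defs.
From mathcomp Require Import all_boot all_order all_algebra.
From mathcomp Require Import complex.
From mathcomp Require Import all_classical all_reals all_analysis.
From mathcomp Require Import ring lra.

Set Implicit Arguments.
Unset Strict Implicit.
Unset Printing Implicit Defensive.

Import Order.TTheory GRing.Theory Num.Theory.
Import ComplexField.Normc.
Import numFieldNormedType.Exports.

Local Open Scope classical_set_scope.
Local Open Scope complex_scope.
Local Open Scope ring_scope.

(** * The squared norm of l2(Z) *)

Lemma l2Z_eq (R : realType) (x y : l2Z R) : (forall n, x n = y n) -> x = y.
Proof. by move=> xy; apply/val_inj/funext. Qed.

Lemma coordB (R : realType) (x y : l2Z R) n : l2Z_fun (x - y) n = x n - y n.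
Proof. by []. Qed.

Lemma sqr_normc (R : rcfType) (z : R[i]) :
  normc z ^+ 2 = complex.Re z ^+ 2 + complex.Im z ^+ 2.
Proof. by case: z => a b /=; rewrite sqr_sqrtr ?addr_ge0 ?sqr_ge0. Qed.

Lemma normc_real (R : rcfType) (a : R) : normc a%:C = `|a|.
Proof. by rewrite /= expr0n addr0 sqrtr_sqr. Qed.

Lemma normc_ge0 (R : rcfType) (z : R[i]) : 0 <= normc z.
Proof. by case: z => a b; exact: sqrtr_ge0. Qed.

Lemma normc_gt0 (R : rcfType) (z : R[i]) : z != 0 -> 0 < normc z.
Proof.
move=> z0; rewrite lt_neqAle normc_ge0 andbT eq_sym.
by apply: contra z0 => /eqP /eq0_normc ->.
Qed.

Lemma psumZS (R : realType) (f : int -> R) N :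
  psumZ f N.+1 = psumZ f N + (f (Posz N) + f (Negz N)).
Proof. by rewrite /psumZ big_ord_recr. Qed.

Lemma psumZ0 (R : realType) (f : int -> R) : psumZ f 0 = 0.
Proof. by rewrite /psumZ big_ord0. Qed.

Lemma psumZ_nd (R : realType) (f : int -> R) : (forall n, 0 <= f n) ->
  {homo psumZ f : m n / (m <= n)%N >-> m <= n}.
Proof.
by move=> f0; apply/nondecreasing_seqP => N; rewrite psumZS lerDl addr_ge0.
Qed.

Definition sq (R : realType) (x : int -> R[i]) (n : int) : R := normc (x n) ^+ 2.

(** Estimates are made on the squared norm, which is a plain sum over Z; [l2normE] and
    [bounded_operatorP] translate back. *)
Definition nsq (R : realType) (x : l2Z R) : R := sumZ (sq x).

Lemma sq_ge0 (R : realType) (x : int -> R[i]) n : 0 <= sq x n.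
Proof. exact: sqr_ge0. Qed.

Lemma psumZ_ge0 (R : realType) (f : int -> R) N :
  (forall n, 0 <= f n) -> 0 <= psumZ f N.
Proof. by move=> f0; rewrite sumr_ge0 // => k _; rewrite addr_ge0. Qed.

Lemma nsq_cvg (R : realType) (x : l2Z R) : cvgn (psumZ (sq x)).
Proof. by case: x => f /= /asboolP. Qed.

Lemma psumZ_le_nsq (R : realType) (x : l2Z R) N : psumZ (sq x) N <= nsq x.
Proof.
by apply: nondecreasing_cvgn_le; [exact: psumZ_nd (sq_ge0 x)|exact: nsq_cvg].
Qed.

Lemma nsq_le (R : realType) (x : l2Z R) M :
  (forall N, psumZ (sq x) N <= M) -> nsq x <= M.
Proof. by move=> xM; apply: limr_le; [exact: nsq_cvg|exact: nearW]. Qed.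

Lemma nsq_ge0 (R : realType) (x : l2Z R) : 0 <= nsq x.
Proof. by apply: le_trans (psumZ_le_nsq x 0); rewrite psumZ0. Qed.

Lemma coord_le (R : realType) (x : l2Z R) n : sq x n <= nsq x.
Proof.
case: n => k; apply: le_trans (psumZ_le_nsq x k.+1);
  rewrite psumZS addrA.
  by rewrite addrAC lerDr addr_ge0 ?psumZ_ge0 ?sq_ge0 // => ?; exact: sq_ge0.
by rewrite lerDr addr_ge0 ?psumZ_ge0 ?sq_ge0 // => ?; exact: sq_ge0.
Qed.

Lemma nsq_eq0 (R : realType) (x : l2Z R) : nsq x <= 0 -> x = 0.
Proof.
move=> x0; apply: l2Z_eq => n; apply: eq0_normc; apply/eqP.
by rewrite -sqrf_eq0 eq_le sqr_ge0 andbT (le_trans (coord_le x n)).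
Qed.

Lemma nsq_dom (R : realType) (x y : l2Z R) C :
  (forall n, sq x n <= C * sq y n) -> 0 <= C -> nsq x <= C * nsq y.
Proof.
move=> xy C0; apply: nsq_le => N.
apply: (le_trans _ (ler_wpM2l C0 (psumZ_le_nsq y N))).
rewrite /psumZ mulr_sumr; apply: ler_sum => k _.
by rewrite mulrDr lerD.
Qed.

(** The factor 2 comes from |a + b|^2 <= 2|a|^2 + 2|b|^2, summed termwise. The contraction factor
    1/4 used for the Neumann series is small enough to absorb it. *)
Lemma nsqD (R : realType) (x y : l2Z R) :
  nsq (x + y) <= 2 * nsq x + 2 * nsq y.
Proof.
apply: nsq_le => N.
apply: (@le_trans _ _ (2 * psumZ (sq x) N + 2 * psumZ (sq y) N)).
  rewrite /psumZ !mulr_sumr -big_split; apply: ler_sum => k _ /=.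
  by rewrite !mulrDr addrACA lerD // normc_sqrD.
by rewrite lerD // ler_wpM2l // psumZ_le_nsq.
Qed.

Lemma nsqZ (R : realType) c (x : l2Z R) : nsq (c *: x) <= normc c ^+ 2 * nsq x.
Proof.
apply: nsq_dom (sqr_ge0 _) => n.
by rewrite -exprMn -normcM.
Qed.

Lemma nsqN (R : realType) (x : l2Z R) : nsq (- x) = nsq x.
Proof.
by rewrite /nsq; congr sumZ; apply/funext => n; rewrite /sq (normcN (x n)).
Qed.

Lemma nsqB (R : realType) (x y : l2Z R) :
  nsq (x - y) <= 2 * nsq x + 2 * nsq y.
Proof. by rewrite -(nsqN y) nsqD. Qed.

Lemma nsq0 (R : realType) : nsq (0 : l2Z R) = 0.
Proof.
apply/eqP; rewrite eq_le nsq_ge0 andbT; apply: nsq_le => N.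
by rewrite /psumZ big1 // => k _; rewrite /sq !normc0 expr0n addr0.
Qed.

Lemma l2Z_mk (R : realType) (f : int -> R[i]) M :
  (forall N, psumZ (sq f) N <= M) ->
  exists x : l2Z R, (forall n, x n = f n) /\ nsq x <= M.
Proof.
move=> fM.
have Pf : square_summable f by apply/(square_summableP f); exists M.
by exists (L2Z Pf); split=> //; exact: nsq_le.
Qed.

Lemma l2normE (R : realType) (x : l2Z R) : l2norm x = Num.sqrt (nsq x).
Proof.
rewrite /l2norm /inner /nsq /sumZC /=; congr (Num.sqrt (sumZ _)).
apply/funext => n; rewrite /sq sqr_normc; case: (x n) => a b /=.
by rewrite mulrN opprK -!expr2.
Qed.

Lemma bounded_operatorP (R : realType) (T : l2Z R -> l2Z R) :
  bounded_operator T <->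
  linear T /\ exists2 C : R, 0 <= C & forall x, nsq (T x) <= C * nsq x.
Proof.
split=> -[lT [M]].
  (* Squaring also makes the constant nonnegative, whatever the sign of [M]. *)
  move=> TM; split=> //; exists (M ^+ 2); first exact: sqr_ge0.
  move=> x; move: (TM x); rewrite !l2normE => h.
  rewrite -(sqr_sqrtr (nsq_ge0 (T x))) -(sqr_sqrtr (nsq_ge0 x)) -exprMn.
  by rewrite lerXn2r // nnegrE ?sqrtr_ge0 // (le_trans _ h) ?sqrtr_ge0.
move=> M0 TM; split=> //; exists (Num.sqrt M) => x.
by rewrite !l2normE -sqrtrM // ler_wsqrtr.
Qed.

Lemma linear_0 (R : realType) (T : l2Z R -> l2Z R) : linear T -> T 0 = 0.
Proof. by move=> lT; have := lT (-1) 0 0; rewrite scaler0 addr0 scaleN1r addNr. Qed.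

Lemma linear_D (R : realType) (T : l2Z R -> l2Z R) x y :
  linear T -> T (x + y) = T x + T y.
Proof. by move=> lT; have := lT 1 x y; rewrite !scale1r. Qed.

Lemma linear_Z (R : realType) (T : l2Z R -> l2Z R) c x :
  linear T -> T (c *: x) = c *: T x.
Proof. by move=> lT; have := lT c x 0; rewrite (linear_0 lT) !addr0. Qed.

Lemma linear_B (R : realType) (T : l2Z R -> l2Z R) x y :
  linear T -> T (x - y) = T x - T y.
Proof. by move=> lT; rewrite (linear_D _ _ lT) -scaleN1r (linear_Z _ _ lT) scaleN1r. Qed.

Lemma linear_comb (R : realType) (S T : l2Z R -> l2Z R) c :
  linear S -> linear T -> linear (fun x => S x + c *: T x).
Proof.
move=> lS lT a x y; rewrite lS lT !scalerDr !scalerA mulrC -!addrA.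
by congr (_ + _); rewrite addrCA.
Qed.

(** Truncation to -N <= n < N, the same window as in [psumZ], written as a combination of basis
    vectors so that linear maps pass through it. *)
Fixpoint trunc (R : realType) (x : l2Z R) (N : nat) : l2Z R :=
  if N is k.+1 then
    trunc x k + (x (Posz k) *: l2Z_basis R (Posz k) +
                 x (Negz k) *: l2Z_basis R (Negz k))
  else 0.

Lemma basisE (R : realType) n m : l2Z_basis R n m = (m == n)%:R.
Proof. by []. Qed.

Lemma truncE (R : realType) (x : l2Z R) N m :
  trunc x N m = if ((if m is Negz k then k else `|m|) < N)%N then x m else 0.
Proof.
elim: N => [|N IH]; first by rewrite ltn0.
rewrite -[LHS]/(trunc x N m + (x (Posz N) * (m == Posz N)%:R +
                 x (Negz N) * (m == Negz N)%:R)) {}IH.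
case: m => k /=; rewrite mulr0 ?addr0 ?add0r [in RHS]ltnS [in RHS]leq_eqVlt.
  rewrite -[Posz k == Posz N]/(k == N).
  by case: eqP => [->|_]; rewrite ?ltnn ?mulr1 ?mulr0 ?add0r ?addr0.
rewrite -[Negz k == Negz N]/(k == N).
by case: eqP => [->|_]; rewrite ?ltnn ?mulr1 ?mulr0 ?add0r ?addr0.
Qed.

Lemma nsq_trunc (R : realType) (x : l2Z R) N :
  nsq (x - trunc x N) <= nsq x - psumZ (sq x) N.
Proof.
have uE m : l2Z_fun (x - trunc x N) m =
    if ((if m is Negz k then k else `|m|) < N)%N then 0 else x m.
  by rewrite coordB truncE; case: ifP; rewrite ?subrr ?subr0.
move: (x - trunc x N) uE => u uE; apply: nsq_le => L.
(* Enlarging the window to at least [N] lets the sum be split at [N], where the coordinates of [u]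
   start to be those of [x]. *)
apply: le_trans (_ : psumZ (sq u) (maxn L N) <= _).
  by apply: psumZ_nd; [exact: sq_ge0|exact: leq_maxl].
rewrite lerBrDr; apply: (le_trans _ (psumZ_le_nsq x (maxn L N))).
have := leq_maxr L N; move: (maxn L N) => {}L NL.
rewrite le_eqVlt; apply/orP; left; apply/eqP.
rewrite /psumZ -(subnKC NL) !big_split_ord /= [X in X + _ + _]big1.
  rewrite add0r addrC; congr (_ + _); apply: eq_bigr => k _; rewrite /sq !uE /=.
  by rewrite ltnNge leq_addr.
by move=> k _; rewrite /sq !uE /= ltn_ord normc0 expr0n addr0.
Qed.

(** Finite combinations of basis vectors are dense: S and T agree on [trunc x N], and the remainder
    x - [trunc x N] tends to 0 in norm. *)
Lemma eq_bounded_operator (R : realType) (S T : l2Z R -> l2Z R) :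
  bounded_operator S -> bounded_operator T ->
  (forall n, S (l2Z_basis R n) = T (l2Z_basis R n)) -> S = T.
Proof.
move=> /bounded_operatorP[lS [C C0 SC]] /bounded_operatorP[lT [D D0 TD]] ST.
apply/funext => x; apply/eqP; rewrite -subr_eq0; apply/eqP; apply: nsq_eq0.
have STt N : S (trunc x N) = T (trunc x N).
  elim: N => [|N IH] /=; first by rewrite (linear_0 lS) (linear_0 lT).
  by rewrite !(linear_D _ _ lS, linear_D _ _ lT)
    !(linear_Z _ _ lS, linear_Z _ _ lT) IH !ST.
have le N : nsq (S x - T x) <= (2 * C + 2 * D) * (nsq x - psumZ (sq x) N).
  have -> : S x - T x = S (x - trunc x N) - T (x - trunc x N).
    by rewrite (linear_B _ _ lS) (linear_B _ _ lT) STt opprB addrA subrK.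
  apply: (le_trans (nsqB _ _)).
  apply: (le_trans (lerD (ler_wpM2l _ (SC _)) (ler_wpM2l _ (TD _)))) => //.
  by rewrite !mulrA -mulrDl ler_wpM2l ?nsq_trunc // addr_ge0 // mulr_ge0.
have cv : (fun N => (2 * C + 2 * D) * (nsq x - psumZ (sq x) N)) @ \oo --> 0.
  rewrite -[X in _ --> X](mulr0 (2 * C + 2 * D)) -(subrr (nsq x)).
  by apply: cvgMr; apply: cvgB; [exact: cvg_cst|exact: nsq_cvg].
rewrite -(cvg_lim _ cv) //; apply: limr_ge; last exact: nearW.
by apply/cvg_ex; exists 0.
Qed.

(** * Shifts and diagonal operators *)

(** Shifting the window -N <= n < N by one gains the index N and loses -N. *)
Lemma psumZ_shift (R : realType) (f : int -> R) N :
  psumZ (fun n => f (n + 1)) N = psumZ f N + (f (Posz N) - f (- Posz N)).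
Proof.
elim: N => [|N IH]; first by rewrite !psumZ0 oppr0 subrr addr0.
rewrite !psumZS {}IH NegzE.
have -> : Posz N + 1 = Posz N.+1 by rewrite -addn1.
have -> : - Posz N.+1 + 1 = - Posz N by rewrite -addn1 PoszD opprD addrK.
by ring.
Qed.

Lemma psumZ_dom_cvg (R : realType) (f g : int -> R) :
  (forall n, `|f n| <= g n) -> cvgn (psumZ g) -> cvgn (psumZ f).
Proof.
have psE h : psumZ h = series (fun k => h (Posz k) + h (Negz k)) :> (nat -> R).
  by apply/funext => N; rewrite /series /= big_mkord.
move=> fg; rewrite !psE => cg; apply: normed_cvg.
apply: series_le_cvg cg => k //=.
  by rewrite addr_ge0 // (le_trans _ (fg _)).
by rewrite (le_trans (ler_normD _ _)) // lerD.
Qed.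

Lemma psumZ_cvg0 (R : realType) (f : int -> R) :
  (forall n, 0 <= f n) -> cvgn (psumZ f) ->
  (fun N => f (Posz N)) @ \oo --> 0 /\ (fun N => f (Negz N)) @ \oo --> 0.
Proof.
have psE h : psumZ h = series (fun k => h (Posz k) + h (Negz k)) :> (nat -> R).
  by apply/funext => N; rewrite /series /= big_mkord.
move=> f0; rewrite psE => /cvg_series_cvg_0 cf.
by split; apply: (squeeze_cvgr _ (cvg_cst 0) cf); apply: nearW => N;
  rewrite f0 ?lerDl ?lerDr f0.
Qed.

(** The two boundary terms of [psumZ_shift] tend to 0, being dominated by terms of a convergent
    sum. *)
Lemma sumZ_shift (R : realType) (f g : int -> R) :
  (forall n, `|f n| <= g n) -> cvgn (psumZ g) ->
  sumZ (fun n => f (n + 1)) = sumZ f.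
Proof.
move=> fg cg; have cf := psumZ_dom_cvg fg cg.
have [gP gN] := psumZ_cvg0 (fun n => le_trans (normr_ge0 _) (fg n)) cg.
have f0 (u : nat -> int) : g (u n) @[n --> \oo] --> 0 -> f (u n) @[n --> \oo] --> 0.
  move=> gu; apply: (squeeze_cvgr _ _ gu (f := fun n => - g (u n))).
    by apply: nearW => n; rewrite -ler_norml.
  by rewrite -oppr0; apply: cvgN.
rewrite /sumZ (_ : psumZ _ = fun N => psumZ f N + (f (Posz N) - f (- Posz N))).
  apply: cvg_lim => //; rewrite -[X in _ --> X]addr0; apply: cvgD => //.
  rewrite -[X in _ --> X](subrr 0); apply: cvgB; first exact: f0.
  rewrite -cvg_shiftS /=; under eq_fun => n do rewrite -NegzE.
  exact: f0.
by apply/funext => N; rewrite psumZ_shift.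
Qed.

Lemma sumZ_single (R : realType) (f : int -> R) m :
  (forall n, n != m -> f n = 0) -> sumZ f = f m.
Proof.
(* The index [m] lies in the window of the N-th partial sum exactly when d < N. *)
move=> f0; pose d := if m is Negz k then k else `|m|%N.
have fE N : psumZ f N = if (d < N)%N then f m else 0.
  elim: N => [|N IH]; first by rewrite psumZ0 ltn0.
  rewrite psumZS {}IH /d; case: m f0 @d => k f0 /=.
    rewrite (f0 (Negz N)) // addr0 [in RHS]ltnS [in RHS]leq_eqVlt.
    case: eqP => [->|kN]; first by rewrite ltnn add0r.
    by rewrite (f0 (Posz N)) ?addr0 //; apply: contra_not_neq kN => -[].
  rewrite (f0 (Posz N)) // add0r [in RHS]ltnS [in RHS]leq_eqVlt.
  case: eqP => [->|kN]; first by rewrite ltnn add0r.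
  by rewrite (f0 (Negz N)) ?addr0 //; apply: contra_not_neq kN => -[].
apply: (@lim_near_cst) => //; exists d.+1 => // N /= dN.
by rewrite fE dN.
Qed.

Lemma sumZ0 (R : realType) (f : int -> R) : (forall n, f n = 0) -> sumZ f = 0.
Proof. by move=> f0; rewrite (@sumZ_single _ _ 0). Qed.

Lemma inner_basisl (R : realType) (y : l2Z R) m :
  inner (l2Z_basis R m) y = (y m)^*.
Proof.
rewrite /inner /sumZC !(@sumZ_single _ _ m); last 2 first.
- by move=> n /negbTE nm; rewrite basisE nm mul0r.
- by move=> n /negbTE nm; rewrite basisE nm mul0r.
by rewrite basisE eqxx mul1r; case: (y m).
Qed.

Lemma shift_sum_l (R : realType) (x : l2Z R) N :
  psumZ (sq (fun n => x (n + 1))) N <= nsq x.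
Proof.
apply: (le_trans _ (psumZ_le_nsq x N.+1)).
rewrite (psumZ_shift (sq x)) psumZS lerD2l.
by rewrite lerD // (le_trans _ (sq_ge0 _ _)) // oppr_le0 sq_ge0.
Qed.

Lemma shift_sum_r (R : realType) (x : l2Z R) N :
  psumZ (sq (fun n => x (n - 1))) N <= nsq x.
Proof.
case: N => [|N]; first by rewrite psumZ0 nsq_ge0.
have := psumZ_shift (sq (fun n => x (n - 1))) N.+1.
have -> : psumZ (fun n => sq (fun n => x (n - 1)) (n + 1)) N.+1 = psumZ (sq x) N.+1.
  by congr psumZ; apply/funext => n; rewrite /sq addrK.
move=> e; apply: (le_trans _ (psumZ_le_nsq x N.+2)).
rewrite [leRHS]psumZS e -addrA lerDl /sq.
have -> : - Posz N.+1 - 1 = Negz N.+1 by rewrite NegzE -opprD -PoszD addn1.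
by rewrite addrA -[_ - _ + _ + _]addrA addrACA addNr addr0 addr_ge0 ?sqr_ge0.
Qed.

Lemma shl_subproof (R : realType) (x : l2Z R) :
  square_summable (fun n => x (n + 1)).
Proof.
apply/(square_summableP (fun n => x (n + 1))).
by exists (nsq x); exact: shift_sum_l.
Qed.

Lemma shr_subproof (R : realType) (x : l2Z R) :
  square_summable (fun n => x (n - 1)).
Proof.
apply/(square_summableP (fun n => x (n - 1))).
by exists (nsq x); exact: shift_sum_r.
Qed.

Definition shl (R : realType) (x : l2Z R) : l2Z R := L2Z (shl_subproof x).

(** The unweighted shift e_n -> e_(n+1), called V in the overview; [shl] is its inverse and its
    adjoint. *)
Definition shr (R : realType) (x : l2Z R) : l2Z R := L2Z (shr_subproof x).

Lemma shlK (R : realType) : cancel (@shl R) (@shr R).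
Proof. by move=> x; apply: l2Z_eq => n /=; rewrite subrK. Qed.

Lemma shrK (R : realType) : cancel (@shr R) (@shl R).
Proof. by move=> x; apply: l2Z_eq => n /=; rewrite addrK. Qed.

(** Both shifts do not increase the norm and they are mutually inverse, so they are isometries. *)
Lemma nsq_shl (R : realType) (x : l2Z R) : nsq (shl x) = nsq x.
Proof.
have le_l y : nsq (shl y) <= nsq y by apply: nsq_le; exact: shift_sum_l.
have le_r y : nsq (shr y) <= nsq y by apply: nsq_le; exact: shift_sum_r.
by apply/eqP; rewrite eq_le le_l -{1}(shlK x) le_r.
Qed.

Lemma nsq_shr (R : realType) (x : l2Z R) : nsq (shr x) = nsq x.
Proof. by rewrite -nsq_shl shrK. Qed.

Lemma shl_bounded (R : realType) : bounded_operator (@shl R).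
Proof.
apply/bounded_operatorP; split; last by exists 1 => // x; rewrite nsq_shl mul1r.
by move=> c x y; apply: l2Z_eq.
Qed.

Lemma shr_bounded (R : realType) : bounded_operator (@shr R).
Proof.
apply/bounded_operatorP; split; last by exists 1 => // x; rewrite nsq_shr mul1r.
by move=> c x y; apply: l2Z_eq.
Qed.

Lemma bounded_comp (R : realType) (S T : l2Z R -> l2Z R) :
  bounded_operator S -> bounded_operator T -> bounded_operator (S \o T).
Proof.
move=> /bounded_operatorP[lS [C C0 SC]] /bounded_operatorP[lT [D D0 TD]].
apply/bounded_operatorP; split; first by move=> c x y /=; rewrite lT lS.
exists (C * D); first exact: mulr_ge0.
by move=> x /=; rewrite (le_trans (SC _)) // -mulrA ler_wpM2l.
Qed.

Lemma shr_basis (R : realType) n : shr (l2Z_basis R n) = l2Z_basis R (n + 1).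
Proof. by apply: l2Z_eq => m /=; rewrite subr_eq. Qed.

Definition bounded_weight (R : realType) (w : int -> R) : Prop :=
  exists M, forall n, `|w n| <= M.

(* Junk value 0 when [w * x] is not square summable, which needs [w] unbounded. *)
Definition diag (R : realType) (w : int -> R) (x : l2Z R) : l2Z R :=
  insubd 0 (fun n => (w n)%:C * x n).

Lemma sq_diag (R : realType) (w : int -> R) (x : int -> R[i]) n :
  sq (fun n => (w n)%:C * x n) n = w n ^+ 2 * sq x n.
Proof. by rewrite /sq normcM exprMn normc_real real_normK ?num_real. Qed.

Lemma diagE (R : realType) (w : int -> R) (x : l2Z R) n :
  bounded_weight w -> diag w x n = (w n)%:C * x n.
Proof.
move=> [M wM]; rewrite [X in X n = _]val_insubd ifT //.
apply/(square_summableP (fun n => (w n)%:C * x n)); exists (M ^+ 2 * nsq x) => N.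
apply: (le_trans _ (ler_wpM2l (sqr_ge0 _) (psumZ_le_nsq x N))).
rewrite /psumZ mulr_sumr; apply: ler_sum => k _.
have le m : sq (fun n => (w n)%:C * x n) m <= M ^+ 2 * sq x m.
  rewrite sq_diag ler_wpM2r ?sq_ge0 // -(real_normK (num_real (w m))).
  by rewrite lerXn2r // nnegrE ?normr_ge0 // (le_trans _ (wM m)).
by rewrite mulrDr lerD // le.
Qed.

Lemma diag_bounded (R : realType) (w : int -> R) :
  bounded_weight w -> bounded_operator (diag w).
Proof.
move=> bw; apply/bounded_operatorP; split.
  move=> c x y; apply: l2Z_eq => n; rewrite diagE //.
  rewrite -[RHS]/(c * diag w x n + diag w y n) !diagE //.
  by rewrite -[(c *: x + y) n]/(c * x n + y n); ring.
case: (bw) => M wM; exists (M ^+ 2); first exact: sqr_ge0.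
move=> x; apply: nsq_dom; last exact: sqr_ge0.
move=> n; rewrite /sq diagE // normcM exprMn normc_real.
rewrite ler_wpM2r ?sq_ge0 //.
by rewrite lerXn2r // nnegrE ?normr_ge0 // (le_trans _ (wM n)).
Qed.

Lemma diag_basis (R : realType) (w : int -> R) n : bounded_weight w ->
  diag w (l2Z_basis R n) = (w n)%:C *: l2Z_basis R n.
Proof.
move=> bw; apply: l2Z_eq => m; rewrite diagE //.
rewrite -[RHS]/((w n)%:C * l2Z_basis R n m) !basisE.
by case: eqP => [->|_]; rewrite ?mulr0.
Qed.

(** * Polar decomposition and power mean of a weighted shift *)

(** Provides the summable majorant that [sumZ_shift] asks for when an inner product is reindexed. *)
Lemma ReIm_mul_conj_le (R : rcfType) (a b : R[i]) :
  `|complex.Re (a * b^*)| <= normc a ^+ 2 + normc b ^+ 2 /\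
  `|complex.Im (a * b^*)| <= normc a ^+ 2 + normc b ^+ 2.
Proof.
rewrite !sqr_normc; case: a b => [a1 a2] [b1 b2] /=; rewrite !ler_norml.
have := sqr_ge0 (a1 - b1); have := sqr_ge0 (a1 + b1).
have := sqr_ge0 (a2 - b2); have := sqr_ge0 (a2 + b2).
have := sqr_ge0 (a1 - b2); have := sqr_ge0 (a1 + b2).
have := sqr_ge0 (a2 - b1); have := sqr_ge0 (a2 + b1).
have := sqr_ge0 a1; have := sqr_ge0 b1; have := sqr_ge0 a2; have := sqr_ge0 b2.
by move=> *; split; apply/andP; split; nra.
Qed.

Lemma inner_shr (R : realType) (x y : l2Z R) : inner (shr x) y = inner x (shl y).
Proof.
have cg : cvgn (psumZ (fun n => sq (shr x) n + sq y n)).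
  rewrite (_ : psumZ _ = fun N => psumZ (sq (shr x)) N + psumZ (sq y) N).
    by apply: is_cvgD; exact: nsq_cvg.
  by apply/funext => N; rewrite -big_split; apply: eq_bigr => k _; exact: addrACA.
rewrite /inner /sumZC -(@sumZ_shift _ (fun n => complex.Re (shr x n * (y n)^*)) _ _ cg); last first.
  by move=> n; exact: (ReIm_mul_conj_le _ _).1.
rewrite -(@sumZ_shift _ (fun n => complex.Im (shr x n * (y n)^*)) _ _ cg); last first.
  by move=> n; exact: (ReIm_mul_conj_le _ _).2.
by congr (sumZ _ +i* sumZ _); apply/funext => n /=; rewrite addrK.
Qed.

Lemma inner_diag (R : realType) (w : int -> R) (x y : l2Z R) :
  bounded_weight w -> inner (diag w x) y = inner x (diag w y).
Proof.
move=> bw; have E : (fun n => diag w x n * (y n)^*) = fun n => x n * (diag w y n)^*.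
  apply/funext => n; rewrite !diagE //.
  case: (x n) (y n) => [a b] [c d]; rewrite /GRing.mul /=.
  by congr (_ +i* _); ring.
by rewrite /inner E.
Qed.

Lemma inner_eq (R : realType) (x y : l2Z R) :
  (forall z, inner z x = inner z y) -> x = y.
Proof.
move=> xy; apply: l2Z_eq => n; have := xy (l2Z_basis R n).
by rewrite !inner_basisl => /(inv_inj (@conjcK _)).
Qed.

Lemma adjoint_shr_diag (R : realType) (w : int -> R) :
  bounded_weight w -> adjoint (@shr R \o diag w) = diag w \o @shl R.
Proof.
move=> bw; apply: xget_subset1.
  split; first by apply: bounded_comp; [exact: diag_bounded|exact: shl_bounded].
  by move=> x y /=; rewrite inner_shr inner_diag.
move=> S T [_ /= HS] [_ /= HT]; apply/funext => y; apply: inner_eq => z.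
by rewrite -HS HT.
Qed.

Lemma diag_comp (R : realType) (v w : int -> R) :
  bounded_weight v -> bounded_weight w ->
  diag v \o diag w = diag (fun n => v n * w n).
Proof.
move=> bv bw; have bvw : bounded_weight (fun n => v n * w n).
  case: bv bw => [M vM] [N wN]; exists (M * N) => n.
  by rewrite normrM ler_pM.
apply/funext => x; apply: l2Z_eq => n; rewrite /= !diagE //.
by rewrite mulrA rmorphM.
Qed.

Lemma inner_diag_self (R : realType) (w : int -> R) (x : l2Z R) :
  bounded_weight w ->
  inner (diag w x) x = (sumZ (fun n => w n * sq x n))%:C.
Proof.
move=> bw; rewrite /inner /sumZC.
have E n : diag w x n * (x n)^* = (w n * sq x n)%:C.
  rewrite diagE // /sq sqr_normc; case: (x n) => a b; rewrite [LHS]/GRing.mul /=.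
  by congr (_ +i* _); ring.
congr (_ +i* _); first by congr sumZ; apply/funext => n; rewrite E.
by apply: sumZ0 => n; rewrite E.
Qed.

Lemma cvg_weight_sq (R : realType) (w : int -> R) (x : l2Z R) :
  bounded_weight w -> cvgn (psumZ (fun n => w n * sq x n)).
Proof.
move=> [M wM]; apply: (@psumZ_dom_cvg _ _ (fun n => M * sq x n)).
  by move=> n; rewrite normrM (ger0_norm (sq_ge0 x n)) ler_wpM2r ?sq_ge0.
rewrite (_ : psumZ _ = fun N => M * psumZ (sq x) N).
  by apply: is_cvgMr; exact: nsq_cvg.
by apply/funext => N; rewrite /psumZ mulr_sumr; apply: eq_bigr => k _; rewrite mulrDr.
Qed.

Lemma sumZ_ge (R : realType) (f : int -> R) n : (forall k, 0 <= f k) ->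
  cvgn (psumZ f) -> f n <= sumZ f.
Proof.
move=> f0 cf; have le N : psumZ f N <= sumZ f.
  by apply: nondecreasing_cvgn_le; [exact: psumZ_nd|].
case: n => k; apply: le_trans (le k.+1); rewrite psumZS addrA.
  by rewrite addrAC lerDr addr_ge0 ?psumZ_ge0.
by rewrite lerDr addr_ge0 ?psumZ_ge0.
Qed.

(** The point is uniqueness. Let D = [diag w] and let S be positive with S^2 = D^2. Then S commutes
    with D, so y = Sx - Dx satisfies Sy = -Dy. Hence 0 <= (Sy, y) = -(Dy, y) <= 0, and y = 0 because
    all weights are positive. *)
Lemma sqrt_diag (R : realType) (w : int -> R) :
  (forall n, 0 < w n) -> bounded_weight w ->
  sqrt_operator (diag (fun n => w n * w n)) = diag w.
Proof.
move=> w0 bw; have w0' n : 0 <= w n := ltW (w0 n).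
have pos (x : l2Z R) : 0 <= sumZ (fun n => w n * sq x n).
  apply: (@le_trans _ _ (w 0 * sq x 0)).
    by rewrite mulr_ge0 ?sq_ge0.
  apply: (@sumZ_ge _ (fun n => w n * sq x n)); last exact: cvg_weight_sq.
  by move=> k; rewrite mulr_ge0 ?sq_ge0.
suff uniq S : positive_operator S -> S \o S = diag (fun n => w n * w n) ->
    S = diag w.
  apply: xget_subset1; last by move=> S T [/uniq U1 /U1 ->] [/uniq V1 /V1 ->].
  split; last by rewrite diag_comp.
  split; first exact: diag_bounded.
  by move=> x; rewrite inner_diag_self // lecE /= eqxx pos.
move=> [bS posS] SS; have := bS => /bounded_operatorP[lS _].
have bww : bounded_weight (fun n => w n * w n).
  by case: bw => M wM; exists (M * M) => n; rewrite normrM ler_pM.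
(* S commutes with S^2 = diag (w^2), so its (m, n) entry vanishes unless
   w m ^ 2 = w n ^ 2, that is w m = w n. *)
have comm : S \o diag w = diag w \o S.
  apply: eq_bounded_operator => [||n]; try by apply: bounded_comp => //; exact: diag_bounded.
  rewrite /= diag_basis // (linear_Z _ _ lS); apply: l2Z_eq => m; rewrite diagE //.
  rewrite -[LHS]/((w n)%:C * S (l2Z_basis R n) m).
  have := congr1 (fun T : l2Z R -> l2Z R => l2Z_fun (T (S (l2Z_basis R n))) m) SS.
  have := congr1 (fun T : l2Z R -> l2Z R => l2Z_fun (S (T (l2Z_basis R n))) m) SS; rewrite /= => ->.
  rewrite diag_basis // (linear_Z _ _ lS) diagE //.
  rewrite -[X in X = _ -> _]/((w n * w n)%:C * S (l2Z_basis R n) m) => /eqP.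
  rewrite -subr_eq0 -mulrBl mulf_eq0 => /orP[|/eqP ->]; last by rewrite !mulr0.
  rewrite -rmorphB /= => /eqP/complexI /eqP.
  by rewrite subr_eq0 -!expr2 eqrXn2 // => /eqP ->.
apply/funext => x; apply/eqP; rewrite -subr_eq0; apply/eqP.
set y := S x - diag w x.
have /bounded_operatorP[lw _] := diag_bounded bw.
have Sy : S y = diag w (- y).
  rewrite /y opprB (linear_B _ _ lS) (linear_B _ _ lw).
  by rewrite -[S (S x)]/((S \o S) x) SS -diag_comp // -[S (diag w x)]/((S \o diag w) x) comm.
have := posS y; rewrite Sy.
have -> : diag w (- y) = diag (fun n => - w n) y.
  have bN : bounded_weight (fun n => - w n).
    by case: bw => M wM; exists M => n; rewrite normrN.
  by apply: l2Z_eq => n; rewrite !diagE // rmorphN mulNr -mulrN.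
rewrite inner_diag_self; last by case: bw => M wM; exists M => n; rewrite normrN.
rewrite lecE /= eqxx /=.
have -> : sumZ (fun n => - w n * sq y n) = - sumZ (fun n => w n * sq y n).
  rewrite /sumZ -limN; last exact: cvg_weight_sq.
  congr (limn _); apply/funext => N; rewrite /psumZ -[RHS]sumrN.
  by apply: eq_bigr => k _; rewrite !mulNr opprD.
rewrite oppr_ge0 => le0; apply: l2Z_eq => n; apply: eq0_normc; apply/eqP.
rewrite -sqrf_eq0 -[_ == 0]/(sq y n == 0) -(mulrI_eq0 _ (mulfI (lt0r_neq0 (w0 n)))).
rewrite eq_le mulr_ge0 ?sq_ge0 // andbT (le_trans _ le0) //.
apply: (@sumZ_ge _ (fun n => w n * sq y n)); last exact: cvg_weight_sq.
by move=> k; rewrite mulr_ge0 ?sq_ge0.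
Qed.

(** The shift cancels against its inverse in the product of the adjoint and the operator, which
    leaves the diagonal operator with weights w_n^2. *)
Lemma abs_shr_diag (R : realType) (w : int -> R) :
  (forall n, 0 < w n) -> bounded_weight w ->
  abs_operator (@shr R \o diag w) = diag w.
Proof.
move=> w0 bw; rewrite /abs_operator adjoint_shr_diag //.
have -> : (diag w \o @shl R) \o (@shr R \o diag w) = diag (fun n => w n * w n).
  by rewrite -diag_comp //; apply/funext => x /=; rewrite shrK.
exact: sqrt_diag.
Qed.

Lemma diag_inj (R : realType) (w : int -> R) (x : l2Z R) :
  (forall n, 0 < w n) -> bounded_weight w -> diag w x = 0 -> x = 0.
Proof.
move=> w0 bw /(congr1 (@l2Z_fun R)) x0; apply: l2Z_eq => n.
have /eqP := congr1 (fun f => f n) x0; rewrite diagE // mulf_eq0.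
by case/orP => [|/eqP //]; rewrite (inj_eq (@complexI R)) gt_eqF.
Qed.

(** Since |W| e_n = w_n e_n with w_n nonzero, the factorisation through |W| fixes the isometric
    factor on the basis. Both kernels are trivial. *)
Lemma polar_shr_diag (R : realType) (w : int -> R) :
  (forall n, 0 < w n) -> bounded_weight w ->
  polar_isometry (@shr R \o diag w) = @shr R.
Proof.
move=> w0 bw; rewrite /polar_isometry abs_shr_diag //.
have sh0 x : shr x = 0 :> l2Z R -> x = 0.
  by move=> x0; apply: nsq_eq0; rewrite -nsq_shr x0 nsq0.
have [lr _] := shr_bounded R; have [ld _] := diag_bounded bw.
apply: xget_subset1 => [|U V].
  split=> //; last first.
    apply/seteqP; split=> x; rewrite /kernel_operator /=.
      by move/sh0 ->; rewrite (linear_0 ld) (linear_0 lr).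
    by move/sh0/(diag_inj w0 bw) ->; rewrite (linear_0 lr).
  by split; [exact: shr_bounded|move=> x _; rewrite !l2normE nsq_shr].
suff uniq T : partial_isometry T -> @shr R \o diag w = T \o diag w -> T = @shr R.
  by move=> [/uniq U1 _ /U1 ->] [/uniq V1 _ /V1 ->].
move=> [bT _] ST; apply: (eq_bounded_operator bT (shr_bounded R)) => n.
have [lT _] := bT.
have := congr1 (fun F => F (l2Z_basis R n)) ST.
rewrite /= diag_basis // (linear_Z _ _ lr) (linear_Z _ _ lT) => /scalerI -> //.
by rewrite (inj_eq (@complexI R)) gt_eqF.
Qed.

Lemma weighted_shiftE (R : realType) (alpha : int -> R) W :
  bilateral_weighted_shift alpha W ->
  bounded_weight alpha /\ W = @shr R \o diag alpha.
Proof.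
move=> [a0 [M aM] bW We].
have ba : bounded_weight alpha by exists M => n; rewrite gtr0_norm.
split=> //; apply: eq_bounded_operator => // [|n].
  by apply: bounded_comp; [exact: shr_bounded|exact: diag_bounded].
have [lr _] := shr_bounded R.
by rewrite We /= diag_basis // (linear_Z _ _ lr) shr_basis.
Qed.

Definition mean_weight (R : realType) (lambda : R) (alpha : int -> R) (n : int) : R :=
  ((1 - lambda) * Num.sqrt (alpha n) + lambda * Num.sqrt (alpha (n + 1))) ^+ 2.

Lemma bounded_sqrt (R : realType) (w : int -> R) :
  bounded_weight w -> bounded_weight (fun n => Num.sqrt (w n)).
Proof.
move=> [M wM]; exists (Num.sqrt M) => n.
by rewrite ger0_norm ?sqrtr_ge0 // ler_wsqrtr // (le_trans (ler_norm _)).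
Qed.

Lemma bounded_mean_weight (R : realType) (lambda : R) (w : int -> R) :
  bounded_weight w -> bounded_weight (mean_weight lambda w).
Proof.
move=> /bounded_sqrt[M wM]; exists ((`|1 - lambda| * M + `|lambda| * M) ^+ 2) => n.
rewrite normrX lerXn2r ?nnegrE // ?addr_ge0 ?mulr_ge0 ?(le_trans _ (wM 0)) //.
by rewrite (le_trans (ler_normD _ _)) // !normrM lerD // ler_wpM2l.
Qed.

(** The operator, its Duggal transform and its Aluthge transform are shifts with weights w_n,
    w_(n+1) and sqrt (w_n w_(n+1)); their combination is a perfect square. *)
Lemma power_mean_shr_diag (R : realType) (lambda : R) (w : int -> R) :
  (forall n, 0 < w n) -> bounded_weight w ->
  power_mean lambda (@shr R \o diag w) = @shr R \o diag (mean_weight lambda w).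
Proof.
move=> w0 bw; rewrite /power_mean /duggal /aluthge polar_shr_diag // abs_shr_diag //.
have bs := bounded_sqrt bw.
have -> : sqrt_operator (diag w) = diag (fun n => Num.sqrt (w n)).
  have s0 n : 0 < Num.sqrt (w n) by rewrite sqrtr_gt0.
  have := sqrt_diag s0 bs; congr (sqrt_operator (diag _) = _).
  by apply/funext => n; rewrite -expr2 sqr_sqrtr // ltW.
have bm := bounded_mean_weight lambda bw.
apply/funext => x; apply: l2Z_eq => n.
rewrite /= diagE //.
set a := ((1 - lambda) ^+ 2)%:C; set b := (lambda ^+ 2)%:C.
set c := (2 * lambda * (1 - lambda))%:C.
rewrite -[LHS]/(a * diag w x (n - 1) + b * diag w (shr x) n +
  c * diag (fun n => Num.sqrt (w n)) (shr (diag (fun n => Num.sqrt (w n)) x)) n).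
rewrite !diagE //= !diagE // /mean_weight subrK !mulrA -!mulrDl.
congr (_ * _); rewrite /a /b /c -!rmorphM -!rmorphD /=; congr (_%:C).
rewrite -{1}(sqr_sqrtr (ltW (w0 n))) -{1}(sqr_sqrtr (ltW (w0 (n - 1)))); ring.
Qed.

(** * Resolvents of weighted shifts *)

(** Injectivity makes the chosen solutions unique, which forces the choice function to be linear. *)
Lemma invertible_of_solution (R : realType) (T : l2Z R -> l2Z R) (C : R) :
  linear T -> (forall x, T x = 0 -> x = 0) -> 0 <= C ->
  (forall x, exists y, T y = x /\ nsq y <= C * nsq x) -> invertible T.
Proof.
move=> lT T0 C0 /choice[S ST].
have inj x y : T x = T y -> x = y.
  move=> Txy; apply/eqP; rewrite -subr_eq0; apply/eqP/T0.
  by rewrite (linear_B _ _ lT) Txy subrr.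
exists S; split=> [|x|x]; [|exact/inj/(ST _).1|exact: (ST x).1].
apply/bounded_operatorP; split; last by exists C => // x; exact: (ST x).2.
by move=> c x y; apply: inj; rewrite lT !(ST _).1.
Qed.

(** The reciprocal weights are bounded by 1/d, so the inverse is the backward shift followed by
    division by the weights. Used in contrapositive form, to get weights that come arbitrarily close
    to 0. *)
Lemma shr_diag_invertible (R : realType) (w : int -> R) (d : R) :
  bounded_weight w -> 0 < d -> (forall n, d <= w n) ->
  invertible (@shr R \o diag w).
Proof.
move=> bw d0 dw; have w0 n : 0 < w n := lt_le_trans d0 (dw n).
have bv : bounded_weight (fun n => (w n)^-1).
  by exists d^-1 => n; rewrite ger0_norm ?invr_ge0 ?(ltW (w0 n)) // lef_pV2 // posrE.
have [lT _] := bounded_comp (shr_bounded R) (diag_bounded bw).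
have /bounded_operatorP[_ [C C0 SC]] := bounded_comp (diag_bounded bv) (shl_bounded R).
apply: (invertible_of_solution lT _ C0) => [x /= Tx0|x].
  apply: (diag_inj w0 bw); apply: nsq_eq0.
  by rewrite -nsq_shr Tx0 nsq0.
exists (diag (fun n => (w n)^-1) (shl x)); split; last exact: SC.
apply: l2Z_eq => n; rewrite /= !diagE //= subrK mulrA -rmorphM /=.
by rewrite divff ?mul1r // gt_eqF.
Qed.

Lemma translate (R : realType) (x : l2Z R) (k : int) :
  exists y : l2Z R, nsq y = nsq x /\ forall n, y n = x (n + k).
Proof.
case: k => k; elim: k => [|k [y [nyx yE]]].
- by exists x; split=> // n; rewrite addr0.
- exists (shl y); rewrite nsq_shl; split=> // n /=.
  by rewrite yE -addrA -PoszD add1n.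
- by exists (shr x); rewrite nsq_shr.
- exists (shr y); rewrite nsq_shr; split=> // n /=.
  by rewrite yE !NegzE -addrA -opprD -PoszD add1n.
Qed.

Lemma sum_sq_le_nsq (R : realType) (x : l2Z R) (k : int) L :
  \sum_(n < L) sq x (k + Posz n) <= nsq x.
Proof.
have [y [<- yE]] := translate x k.
apply: (le_trans _ (psumZ_le_nsq y L)); apply: ler_sum => n _.
by rewrite /sq yE addrC lerDl sqr_ge0.
Qed.

(** The entry from e_k to e_(k+n) of the n-th power of the shift with weights [w]. *)
Definition wprod (R : realType) (w : int -> R) (k : int) (n : nat) : R :=
  \prod_(i < n) w (k + Posz i).

Lemma wprodS (R : realType) (w : int -> R) k n :
  wprod w k n.+1 = wprod w k n * w (k + Posz n).
Proof. by rewrite /wprod big_ord_recr. Qed.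

Lemma wprodD (R : realType) (w : int -> R) k m n :
  wprod w k (m + n) = wprod w k m * wprod w (k + Posz m) n.
Proof.
rewrite /wprod big_split_ord /=; congr (_ * _).
by apply: eq_bigr => i _; rewrite PoszD addrA.
Qed.

Lemma wprod1 (R : realType) (w : int -> R) k : wprod w k 1 = w k.
Proof. by rewrite /wprod big_ord1 addr0. Qed.

(* Datko's argument: the product over n steps factors at each j < n, so the
   uniform bound on the sum of squares forces n copies of the n-step square
   below K^2. *)
Lemma wprod_decay (R : realType) (w : int -> R) (K : R) :
  (forall k L, \sum_(n < L) wprod w k n ^+ 2 <= K) ->
  forall k n, n%:R * wprod w k n ^+ 2 <= K ^+ 2.
Proof.
move=> wK k n.
have w2K l j : wprod w l j ^+ 2 <= K.
  apply: (le_trans _ (wK l j.+1)); rewrite big_ord_recr /= lerDr.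
  by apply: sumr_ge0 => i _; exact: sqr_ge0.
have K0 : 0 <= K := le_trans (sqr_ge0 _) (w2K 0 0%N).
rewrite mulr_natl -[n in _ *+ n]card_ord -sumr_const [leRHS]expr2.
apply: (le_trans _ (ler_wpM2r K0 (wK k n))); rewrite mulr_suml.
apply: ler_sum => j _; rewrite -{1}(subnKC (ltnW (ltn_ord j))) wprodD exprMn.
by rewrite ler_wpM2l ?sqr_ge0.
Qed.

Lemma nsq_basis (R : realType) n : nsq (l2Z_basis R n) = 1.
Proof.
rewrite /nsq (@sumZ_single _ _ n) /sq ?basisE ?eqxx ?normc1 ?expr1n //.
by move=> m /negbTE mn; rewrite basisE mn normc0 expr0n.
Qed.

(* The matrix of the inverse S of T - z has a constant diagonal d.  Its
   superdiagonal is (1 + z d) / w, which must vanish as w is not bounded below;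
   hence d = - 1 / z and S is lower triangular, with entries
   - w_k ... w_(k+n-1) / z^(n+1). *)
Lemma resolvent_decay (R : realType) (w : int -> R) (z : R[i]) :
  (forall n, 0 < w n) -> bounded_weight w -> z != 0 ->
  ~ invertible (@shr R \o diag w) ->
  invertible (fun x => (@shr R \o diag w) x - z *: x) ->
  exists K : R, forall k n, n%:R * wprod (fun i => w i / normc z) k n ^+ 2 <= K.
Proof.
move=> w0 bw z0 ninv [S [/bounded_operatorP[lS [C C0 SC]] TS ST]].
pose s k m := S (l2Z_basis R k) m.
have nz0 := normc_gt0 z0.
(* [row] reads (T - z) S = 1 entrywise, and [col] reads S (T - z) = 1. *)
have row k m : (w (m - 1))%:C * s k (m - 1) - z * s k m = (m == k)%:R.
  by have := congr1 (fun x : l2Z R => x m) (ST (l2Z_basis R k)); rewrite coordB /= diagE.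
have col k m : (w k)%:C * s (k + 1) m - z * s k m = (m == k)%:R.
  have := congr1 (fun x : l2Z R => x m) (TS (l2Z_basis R k)).
  have [lr _] := shr_bounded R.
  rewrite /= diag_basis // (linear_Z _ _ lr) shr_basis (linear_B _ _ lS).
  by rewrite !(linear_Z _ _ lS) coordB.
have sup k : (w k)%:C * s (k + 1) k = 1 + z * s k k.
  by have /eqP := col k k; rewrite eqxx subr_eq => /eqP.
(* [row] on the diagonal and [sup] involve the same superdiagonal term; comparing them and
   cancelling z gives equality. *)
have diagS k : s (k + 1) (k + 1) = s k k.
  have := row (k + 1) (k + 1); rewrite addrK sup eqxx -addrA -[RHS]addr0.
  by move/addrI/eqP; rewrite subr_eq0 eq_sym => /eqP /(mulfI z0).
have diag0 k : s k k = s 0 0.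
  case: k => k; elim: k => [|k <-] //.
  - by rewrite -(diagS (Posz k)) -PoszD addn1.
  - by rewrite -(diagS (Negz 0)).
  - by rewrite -(diagS (Negz k.+1)) [Negz k.+1]NegzE -addn1 PoszD opprD addrNK -NegzE.
have sC k m : sq (S (l2Z_basis R k)) m <= C.
  by apply: (le_trans (coord_le _ _)); apply: (le_trans (SC _)); rewrite nsq_basis mulr1.
have zd : 1 + z * s 0 0 = 0.
  apply: contrapT => /eqP e0; apply: ninv.
  have e1 := normc_gt0 e0; set e := normc _ in e1.
  (* By [sup], w_n times the modulus of a superdiagonal entry equals e. That entry has squared
     modulus at most C, hence modulus at most 1 + C. *)
  apply: (@shr_diag_invertible _ _ (e / (1 + C))) => // [|n].
    by rewrite divr_gt0 // ltr_wpDr.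
  rewrite ler_pdivrMr ?ltr_wpDr // /e -(diag0 n) -sup normcM normc_real gtr0_norm //.
  rewrite ler_pM2l //; have := sC (n + 1) n; rewrite /sq -/(s _ _).
  by have := sqr_ge0 (normc (s (n + 1) n) - 1); nra.
have d0 : normc (s 0 0) * normc z = 1.
  rewrite -normcM mulrC -[z * _](addKr 1) zd addr0.
  by rewrite (normcN (1 : R[i])) normc1.
have low k n : normc (s k (k + Posz n)) = wprod (fun i => w i / normc z) k n * normc (s 0 0).
  elim: n => [|n IH]; first by rewrite addr0 diag0 /wprod big_ord0 mul1r.
  have := row k (k + Posz n.+1).
  have -> : k + Posz n.+1 - 1 = k + Posz n by rewrite -addn1 PoszD addrA addrK.
  have -> : (k + Posz n.+1 == k) = false by rewrite -subr_eq0 addrC addKr.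
  move=> /eqP; rewrite subr_eq0 => /eqP /(congr1 (@normc R)).
  rewrite !normcM normc_real gtr0_norm // IH wprodS => e.
  by apply: (mulIf (lt0r_neq0 nz0)); rewrite [LHS]mulrC -e; field; exact: lt0r_neq0.
(* Column k of S has squared norm at most C, and by [low] its entries from the diagonal on have
   modulus [wprod] / |z|. So the squares of [wprod] sum to at most C |z|^2, which [wprod_decay]
   squares. *)
exists ((C * normc z ^+ 2) ^+ 2); apply: wprod_decay => k L.
rewrite -[X in X <= _]mulr1 -(expr1n _ 2) -d0 exprMn mulrA ler_wpM2r ?sqr_ge0 //.
rewrite mulr_suml; under eq_bigr => n _ do rewrite -exprMn -low.
apply: (le_trans (sum_sq_le_nsq (S (l2Z_basis R k)) k L)).
by apply: (le_trans (SC _)); rewrite nsq_basis mulr1.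
Qed.

(** * Neumann series *)

Lemma cvg_psumZ_sq (R : realType) (v : nat -> int -> R[i]) (f : int -> R[i]) N :
  (forall n, (fun m => complex.Re (v m n)) @ \oo --> complex.Re (f n)) ->
  (forall n, (fun m => complex.Im (v m n)) @ \oo --> complex.Im (f n)) ->
  (fun m => psumZ (sq (v m)) N) @ \oo --> psumZ (sq f) N.
Proof.
move=> cr ci; have csq n : (fun m => sq (v m) n) @ \oo --> sq f n.
  rewrite /sq sqr_normc; under eq_fun => m do rewrite sqr_normc.
  under eq_fun => m do rewrite !expr2.
  by rewrite !expr2; apply: cvgD; apply: cvgM.
elim: N => [|N IH].
  by under eq_fun => m do rewrite psumZ0; rewrite psumZ0; exact: cvg_cst.
under eq_fun => m do rewrite psumZS; rewrite psumZS.
by apply: cvgD => //; exact: cvgD.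
Qed.

Lemma cvg_rate (R : realType) (C : R) : (fun n => C * (1 / 4) ^+ n) @ \oo --> 0.
Proof. by apply: cvg_geometric; rewrite ger0_norm //; lra. Qed.

Lemma real_cauchy_cvg (R : realType) (a : nat -> R) (C : R) :
  (forall n k, (a (n + k)%N - a n) ^+ 2 <= C * (1 / 4) ^+ n) -> cvgn a.
Proof.
move=> aC; apply/cauchy_cvgP/cauchy_exP => e e0.
have /cvgrPdist_lt/(_ _ (exprn_gt0 2 e0))[n _ /(_ n (leqnn n)) /=] := cvg_rate C.
rewrite sub0r normrN => ne; exists (a n); exists n => // m /= nm.
rewrite /ball /= -(ltr_pXn2r (n := 2)) ?nnegrE ?(ltW e0) //.
apply: le_lt_trans ne; rewrite real_normK ?num_real // -sqrrN opprB.
by rewrite -(subnKC nm); apply: le_trans (ler_norm _); exact: aC.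
Qed.

(** Completeness for sequences with a geometric Cauchy rate. The limit is taken coordinatewise, and
    the bound passes to the limit on each finite window. *)
Lemma l2Z_complete (R : realType) (u : nat -> l2Z R) (C : R) :
  (forall n k, nsq (u (n + k)%N - u n) <= C * (1 / 4) ^+ n) ->
  exists y : l2Z R, forall n, nsq (y - u n) <= C * (1 / 4) ^+ n.
Proof.
move=> uC.
have cr j : cvgn (fun n => complex.Re (u n j)).
  apply: (@real_cauchy_cvg _ _ C) => n k.
  apply: le_trans (uC n k); apply: le_trans (coord_le _ j).
  rewrite /sq sqr_normc coordB; case: (u _ j) (u n j) => [a b] [c d] /=.
  by rewrite lerDl sqr_ge0.
have ci j : cvgn (fun n => complex.Im (u n j)).
  apply: (@real_cauchy_cvg _ _ C) => n k.
  apply: le_trans (uC n k); apply: le_trans (coord_le _ j).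
  rewrite /sq sqr_normc coordB; case: (u _ j) (u n j) => [a b] [c d] /=.
  by rewrite lerDr sqr_ge0.
pose f j : R[i] := limn (fun n => complex.Re (u n j)) +i* limn (fun n => complex.Im (u n j)).
have fu n N : psumZ (sq (fun j => f j - u n j)) N <= C * (1 / 4) ^+ n.
  have cv : (fun m => psumZ (sq (fun j => u m j - u n j)) N) @ \oo -->
      psumZ (sq (fun j => f j - u n j)) N.
    apply: cvg_psumZ_sq => j; under eq_fun => m do rewrite raddfB /=.
      by rewrite raddfB /=; apply: cvgB; [exact: cr|exact: cvg_cst].
    by rewrite raddfB /=; apply: cvgB; [exact: ci|exact: cvg_cst].
  rewrite -(cvg_lim _ cv) //; apply: limr_le; first by apply/cvg_ex; eexists; exact: cv.
  exists n => // m /= nm; rewrite -(subnKC nm).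
  exact: le_trans (psumZ_le_nsq _ N) (uC n (m - n)%N).
(* The bounds at hand show that f - u_0, rather than f itself, is square summable; u_0 is added back
   afterwards. *)
have [d [dE _]] := l2Z_mk (fu 0%N).
exists (d + u 0%N) => n; apply: nsq_le => N; apply: le_trans (fu n N).
rewrite le_eqVlt; apply/orP; left; apply/eqP; congr psumZ; apply/funext => j.
rewrite /sq coordB -[(d + u 0%N) j]/(d j + u 0%N j) dE; congr (normc (_ - _) ^+ 2).
exact: subrK.
Qed.

(** Fixed-point iteration of y -> x + B y from 0; the factor 1/4 on squared norms means that B
    halves norms. *)
Lemma contraction_solution (R : realType) (B : l2Z R -> l2Z R) x :
  linear B -> (forall y, nsq (B y) <= 1 / 4 * nsq y) ->
  exists y, y - B y = x /\ nsq y <= 4 * nsq x.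
Proof.
move=> lB nB; pose u n := iter n (fun y => x + B y) 0.
(* The constant 4 is the fixed point of the recursion C = 2 + 2 (1/4) C that [nsqD] yields. *)
have u4 n : nsq (u n) <= 4 * nsq x.
  elim: n => [|n IH]; first by rewrite /u nsq0 mulr_ge0 ?nsq_ge0.
  by rewrite /= (le_trans (nsqD _ _)) //; have := nB (u n); lra.
have uC n k : nsq (u (n + k)%N - u n) <= 4 * nsq x * (1 / 4) ^+ n.
  elim: n => [|n IH]; first by rewrite expr0 mulr1 subr0.
  rewrite addSn /= opprD addrACA subrr add0r -(linear_B _ _ lB) exprS.
  by have := nB (u (n + k)%N - u n); lra.
have [y yu] := l2Z_complete uC.
exists y; split; last by have := yu 0%N; rewrite subr0 expr0 mulr1.
apply/eqP; rewrite -subr_eq0; apply/eqP; apply: nsq_eq0.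
have le n : nsq (y - B y - x) <= 4 * nsq x * (1 / 4) ^+ n.
  have -> : y - B y - x = (y - u n.+1) - B (y - u n).
    rewrite (linear_B _ _ lB) /=; set p := B y; set q := B (u n).
    apply: l2Z_eq => j.
    by rewrite -[LHS]/(y j - p j - x j) -[RHS]/(y j - (x j + q j) - (p j - q j)); ring.
  apply: (le_trans (nsqB _ _)).
  by have := yu n.+1; have := yu n; have := nB (y - u n); rewrite exprS; lra.
rewrite -(cvg_lim _ (@cvg_rate _ (4 * nsq x))) //.
by apply: limr_ge; [apply/cvg_ex; exists 0; exact: cvg_rate|exact: nearW].
Qed.

Lemma bounded_comb (R : realType) (S T : l2Z R -> l2Z R) c :
  bounded_operator S -> bounded_operator T ->
  bounded_operator (fun x => S x + c *: T x).
Proof.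
move=> /bounded_operatorP[lS [C C0 SC]] /bounded_operatorP[lT [D D0 TD]].
apply/bounded_operatorP; split; first exact: linear_comb.
exists (2 * C + 2 * (normc c ^+ 2 * D)) => [|x].
  by rewrite addr_ge0 1?mulr_ge0 1?mulr_ge0 ?sqr_ge0.
have := ler_wpM2l (sqr_ge0 (normc c)) (TD x); have := nsqZ c (T x).
by have := nsqD (S x) (c *: T x); have := SC x; lra.
Qed.

Lemma bounded_id (R : realType) : bounded_operator (@id (l2Z R)).
Proof. by apply/bounded_operatorP; split=> //; exists 1 => // x; rewrite mul1r. Qed.

Lemma bounded_iter (R : realType) (A : l2Z R -> l2Z R) n :
  bounded_operator A -> bounded_operator (iter n A).
Proof.
move=> bA; elim: n => [|n IH]; first exact: bounded_id.
exact: (bounded_comp bA IH).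
Qed.

(* The inverse is - c^-1 (1 + A + ... + A^(N-1)) (1 - A^N)^-1. *)
Lemma invertible_of_power_contraction (R : realType) (A : l2Z R -> l2Z R) c N :
  bounded_operator A -> c != 0 ->
  (forall x, nsq (iter N A x) <= 1 / 4 * nsq x) ->
  invertible (fun x => c *: A x - c *: x).
Proof.
move=> bA c0 AN; have [lA _] := bA.
have [lAN _] := bounded_iter N bA.
pose Q x : l2Z R := \sum_(j < N) iter j A x.
have bQ : bounded_operator Q.
  rewrite /Q; elim: N {AN lAN Q} => [|n IH].
    apply/bounded_operatorP; split=> [a x y|].
      by rewrite !big_ord0 scaler0 addr0.
    by exists 0 => // x; rewrite big_ord0 nsq0 mul0r.
  have := bounded_comb 1 IH (bounded_iter n bA).
  by congr bounded_operator; apply/funext => x; rewrite big_ord_recr scale1r.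
(* Telescoping of the finite geometric sum. *)
have AQ x : A (Q x) - Q x = iter N A x - x.
  rewrite /Q; elim: N {AN lAN Q bQ} => [|n IH].
    by rewrite !big_ord0 (linear_0 lA) !subrr.
  by rewrite !big_ord_recr /= (linear_D _ _ lA) opprD addrACA IH addrC addrA subrK.
have /bounded_operatorP[lQ [C C0 QC]] := bQ.
apply: (@invertible_of_solution _ _ (normc (- c^-1) ^+ 2 * (C * 4))).
- move=> a x y; rewrite -!scalerBr lA scalerA mulrC -scalerA -scalerDr.
  by rewrite opprD addrACA -scalerBr.
- move=> x /eqP; rewrite -scalerBr scaler_eq0 (negbTE c0) subr_eq0 => /eqP Ax.
  (* A fixed point of A is fixed by A^N, so its squared norm is at most a quarter of itself. *)
  apply: nsq_eq0; have := AN x; rewrite (_ : iter N A x = x); first by lra.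
  by elim: N {AN lAN Q bQ AQ lQ QC} => //= n ->.
- by rewrite mulr_ge0 ?sqr_ge0 // mulr_ge0.
move=> x; have [y [yx ny]] := contraction_solution x lAN AN.
exists (- c^-1 *: Q y); split.
  rewrite (linear_Z _ _ lA) -scalerBr -scalerBr AQ scalerA mulrN divff //.
  by rewrite scaleN1r opprB.
have CQ : nsq (Q y) <= C * 4 * nsq x.
  by have := ler_wpM2l C0 ny; have := QC y; lra.
by have := ler_wpM2l (sqr_ge0 (normc (- c^-1))) CQ; have := nsqZ (- c^-1) (Q y); lra.
Qed.

Lemma sq_iter_shr_diag (R : realType) (w : int -> R) (c : R[i]) n (x : l2Z R) k :
  bounded_weight w -> c != 0 ->
  sq (iter n (fun y => c^-1 *: shr (diag w y)) x) (k + Posz n) =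
    wprod (fun i => w i / normc c) k n ^+ 2 * sq x k.
Proof.
move=> bw c0; set F := fun _ => _.
elim: n => [|n IH]; first by rewrite addr0 /wprod big_ord0 expr1n mul1r.
rewrite wprodS exprMn mulrAC -IH /sq.
have -> : l2Z_fun (iter n.+1 F x) (k + Posz n.+1) =
    c^-1 * diag w (iter n F x) (k + Posz n.+1 - 1) by [].
have -> : k + Posz n.+1 - 1 = k + Posz n by rewrite -addn1 PoszD addrA addrK.
rewrite diagE //.
rewrite !normcM normc_real normcV !exprMn real_normK ?num_real //.
ring.
Qed.

(** * Comparison of the weights and inclusion of the spectra *)

Lemma mean_weight_ge (R : realType) (lambda : R) (w : int -> R) n :
  0 <= lambda <= 1 -> (forall n, 0 < w n) ->
  (4 * lambda * (1 - lambda)) ^+ 2 * (w n * w (n + 1)) <= mean_weight lambda w n ^+ 2.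
Proof.
move=> /andP[l0 l1] w0; rewrite /mean_weight.
set a := (1 - lambda) * Num.sqrt (w n); set b := lambda * Num.sqrt (w (n + 1)).
have a0 : 0 <= a by rewrite mulr_ge0 ?sqrtr_ge0 ?subr_ge0.
have b0 : 0 <= b by rewrite mulr_ge0 ?sqrtr_ge0.
(* AM-GM enters as 4ab <= (a + b)^2; squaring both sides removes the roots of the weights on the
   left. *)
have -> : (4 * lambda * (1 - lambda)) ^+ 2 * (w n * w (n + 1)) = (4 * (a * b)) ^+ 2.
  rewrite -{1}(sqr_sqrtr (ltW (w0 n))) -{1}(sqr_sqrtr (ltW (w0 (n + 1)))) /a /b.
  ring.
have ab0 : 0 <= 4 * (a * b) by rewrite mulr_ge0 // mulr_ge0.
rewrite lerXn2r // ?nnegrE ?sqr_ge0 //.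
by have := sqr_ge0 (a - b); rewrite !expr2; lra.
Qed.

Theorem proposition2p9 (R : realType) (lambda : R) (alpha : int -> R)
    (W : l2Z R -> l2Z R) :
  0 <= lambda <= 1 ->
  bilateral_weighted_shift alpha W ->
  ~ invertible (power_mean lambda W) ->
  [set (4 * lambda * (1 - lambda))%:C * gamma | gamma in spectrum W]
    `<=` spectrum (power_mean lambda W).
Proof.
move=> l01 shW ninv _ [gamma gW <-]; rewrite /spectrum /= => inv.
have [a0 _ bW _] := shW; have [ba eW] := weighted_shiftE shW.
move: ninv inv; rewrite eW power_mean_shr_diag //.
set c := 4 * lambda * (1 - lambda); set b := mean_weight lambda alpha => ninv inv.
have bb : bounded_weight b := bounded_mean_weight lambda ba.
(* At z = 0 the assumed invertibility would be that of P_lambda(W) itself. *)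
have z0 : c%:C * gamma != 0.
  apply/eqP => z0; apply: ninv; move: inv; rewrite z0; congr invertible.
  by apply/funext => x; rewrite scale0r subr0.
have c0 : 0 < c.
  have c_ge0 : 0 <= c by case/andP: l01 => l0 l1; rewrite /c !mulr_ge0 ?subr_ge0.
  by rewrite lt_neqAle c_ge0 andbT; apply: contraNneq z0 => <-; rewrite mul0r.
have g0 : gamma != 0 by apply: contraNneq z0 => ->; rewrite mulr0.
have ng0 := normc_gt0 g0; set g := normc gamma in ng0.
have b0 n : 0 < b n.
  rewrite /b /mean_weight exprn_gt0 //; case/andP: l01 => l0 l1.
  have lp : 0 < lambda.
    rewrite lt_neqAle l0 andbT; apply: contraTneq c0 => lambda0.
    by rewrite /c -lambda0 mulr0 mul0r ltxx.
  by rewrite ltr_wpDl ?mulr_ge0 ?subr_ge0 ?sqrtr_ge0 // mulr_gt0 // sqrtr_gt0.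
have [K decay] := resolvent_decay b0 bb z0 ninv inv.
pose t := wprod (fun i => alpha i / g).
pose p := wprod (fun i => b i / normc (c%:C * gamma)).
have t0 k n : 0 <= t k n by apply: prodr_ge0 => i _; rewrite divr_ge0 ?ltW.
(* Product of the AM-GM bounds over n consecutive indices; dividing by |c gamma| cancels c. *)
have tp k n : t k n * t (k + 1) n <= p k n ^+ 2.
  rewrite /t /p /wprod -big_split -prodrXl /=; apply: ler_prod => i _.
  have k1i : k + 1 + Posz i = k + Posz i + 1 by rewrite addrAC.
  apply/andP; split; first by rewrite mulr_ge0 ?divr_ge0 ?ltW.
  rewrite normcM normc_real gtr0_norm // k1i !expr_div_n mulrACA -invfM -/g.
  rewrite ler_pdivlMr; last by rewrite exprn_gt0 // mulr_gt0.
  have -> : alpha (k + Posz i) * alpha (k + Posz i + 1) / (g * g) * (c * g) ^+ 2 =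
      c ^+ 2 * (alpha (k + Posz i) * alpha (k + Posz i + 1)).
    by field; exact: lt0r_neq0.
  exact: mean_weight_ge.
have [M aM] := ba; have M0 : 0 <= M := le_trans (normr_ge0 _) (aM 0).
have aMg i : alpha i / g <= M / g.
  by rewrite ler_pM2r ?invr_gt0 // (le_trans (ler_norm _)).
(* t_(k,n+1) can be split off at its last or its first factor. Multiplying the two bounds produces
   the product t_(k,n) t_(k+1,n) controlled by [tp]. *)
have tS k n : t k n.+1 ^+ 2 <= (M / g) ^+ 2 * p k n ^+ 2.
  have Mg0 : 0 <= M / g by rewrite divr_ge0 // ltW.
  have e1 : t k n.+1 <= M / g * t k n by rewrite /t wprodS mulrC ler_wpM2r // t0.
  have e2 : t k n.+1 <= M / g * t (k + 1) n.
    by rewrite /t -add1n wprodD wprod1 ler_wpM2r // t0.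
  apply: (@le_trans _ _ ((M / g) ^+ 2 * (t k n * t (k + 1) n))).
    by rewrite !expr2 mulrACA ler_pM.
  by rewrite ler_wpM2l ?sqr_ge0.
have [N tN] : exists N, forall k, t k N ^+ 2 <= 1 / 4.
  pose L := (M / g) ^+ 2 * K.
  (* By [tS] and [decay], n t_(k,n+1)^2 <= L; taking n > 4|L| + 1 gives 1/4 for every k at once. *)
  exists (Num.bound (4 * `|L| + 1)).+1 => k; set n := Num.bound _.
  have nL : 4 * `|L| + 1 < n%:R.
    by apply: archi_boundP; rewrite addr_ge0 ?mulr_ge0.
  apply: (le_trans (tS k n)).
  have n0 : 0 < n%:R :> R by apply: le_lt_trans nL; rewrite addr_ge0 ?mulr_ge0.
  have := ler_wpM2l (sqr_ge0 (M / g)) (decay k n); rewrite -/(p k n) -/L.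
  have := ler_norm L; set T := (M / g) ^+ 2 * _ => LL.
  rewrite mulrCA -/T => TL; rewrite -(ler_pM2l n0); lra.
apply: gW; rewrite eW.
pose A y : l2Z R := gamma^-1 *: shr (diag alpha y).
have bsd := bounded_comp (shr_bounded R) (diag_bounded ba).
have bA : bounded_operator A.
  (* Scaling by 1/gamma is written as T + (1/gamma - 1) T to reuse [bounded_comb]. *)
  have := bounded_comb (gamma^-1 - 1) bsd bsd; congr bounded_operator.
  by apply/funext => y; rewrite /A scalerBl scale1r addrC subrK.
have -> : (fun x => (@shr R \o diag alpha) x - gamma *: x) =
    (fun x => gamma *: A x - gamma *: x).
  by apply/funext => y; rewrite /A scalerA divff // scale1r.
apply: (@invertible_of_power_contraction _ _ _ N bA g0) => x.
(* Coordinate m of A^N x depends only on coordinate m - N of x. Replacing x by its N-fold shift, of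
   equal norm, aligns the coordinates for [nsq_dom]. *)
have -> : 1 / 4 * nsq x = 1 / 4 * nsq (iter N (@shr R) x).
  by congr (_ * _); elim: N {tN} => //= n ->; rewrite nsq_shr.
apply: nsq_dom => [m|//].
have shE n m' : iter n (@shr R) x m' = x (m' - Posz n).
  elim: n m' => [|n IH] m'; first by rewrite subr0.
  by rewrite /= IH -addrA -opprD -PoszD add1n.
have -> : sq (iter N (@shr R) x) m = sq x (m - Posz N) by rewrite /sq shE.
rewrite -{1}[m](subrK (Posz N)) sq_iter_shr_diag //.
by rewrite ler_wpM2r ?sqr_ge0.
Qed.
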